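(* Let $n\ge 2$ and let $T\subset\mathbb{R}^{n*}$ be a strictly convex compact body with $C^1$-smooth boundary. Suppose that there exist a strictly convex compact body $K\subset\mathbb{R}^n$ with $C^1$-smooth boundary and a projective billiard structure $(H_q)_{q\in\partial K}$ on $\partial K$ such that the trajectories in $K$ of the Minkowski billiard defined by $T$ coincide, up to reparametrization, with the trajectories of the projective billiard defined by $(H_q)_{q\in\partial K}$. Then $T$ is an ellipsoid.
   Context: $\mathbb{R}^{n*}$ is the dual vector space of $\mathbb{R}^n$; $(\mathbb{R}^{n*})^*$ is canonically identified with $\mathbb{R}^n$, and every tangent space $T_q\mathbb{R}^n$ is identified with $\mathbb{R}^n$ by translation. A body is strictly convex if every line meets its boundary in at most two points. Without loss of generality the origins of $\mathbb{R}^n$ and $\mathbb{R}^{n*}$ are the barycentres of $K$ and $T$. Let $F$ and $\widetilde F$ be the positively 1-homogeneous functions ($F(\lambda v)=\lambda F(v)$, $\widetilde F(\lambda p)=\lambda\widetilde F(p)$ for $\lambda>0$) such that $K=\{q\in\mathbb{R}^n\mid F(q)\le 1\}$ and $T=\{p\in\mathbb{R}^{n*}\mid \widetilde F(p)\le 1\}$. No central symmetry of $K$ or $T$ is assumed. Projective billiard structure on $\partial K$: a family of linear involutions $H_q:\mathbb{R}^n\to\mathbb{R}^n$, $q\in\partial K$, such that each $H_q$ has eigenvalues $1$ and $-1$ and the eigenspace of eigenvalue $1$ is the tangent hyperplane to $\partial K$ at $q$ (so the eigenspace of eigenvalue $-1$ is a line transversal to $\partial K$). No regularity (not even continuity) of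 $q\mapsto H_q$ is assumed. The reflection law at $q$ is $v_{\mathrm{out}}=H_q(v_{\mathrm{in}})$. Minkowski billiard in $K$ defined by $T$: given $q\in\partial K$ and an incoming velocity $v_{\mathrm{in}}\in\mathbb{R}^n=(\mathbb{R}^{n*})^*$, let $p_1\in\partial T$ be the unique point at which $d_{p_1}\widetilde F$ is a positive multiple of $v_{\mathrm{in}}$. Let $\Lambda_q(p_1)=\{p_1+t\,d_qF\mid t\in\mathbb{R}\}\subset\mathbb{R}^{n*}$. If $\Lambda_q(p_1)$ meets $\partial T$ in two points, let $p_2$ be the second one and set $v_{\mathrm{out}}=d_{p_2}\widetilde F\in(\mathbb{R}^{n*})^*=\mathbb{R}^n$; if $\Lambda_q(p_1)$ is tangent to $\partial T$, set $v_{\mathrm{out}}=v_{\mathrm{in}}$. The trajectories of the two billiards coincide up to reparametrization means: for every $q\in\partial K$ and every incoming vector $v_{\mathrm{in}}$ at $q$ (i.e. $d_qF(v_{\mathrm{in}})>0$), the outgoing vector $v_{\mathrm{out}}$ of the Minkowski billiard is a positive multiple of $H_q(v_{\mathrm{in}})$. An ellipsoid is the image of a closed Euclidean ball under an invertible affine map. *)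

(* Defs.v *)
From HB Require Import structures.
From mathcomp Require Import all_boot all_order all_algebra.
From mathcomp Require Import all_classical all_reals all_analysis.

Set Implicit Arguments.
Unset Strict Implicit.
Unset Printing Implicit Defensive.

Import Order.TTheory GRing.Theory Num.Theory.
Import numFieldNormedType.Exports.

Local Open Scope classical_set_scope.
Local Open Scope ring_scope.

(* Vectors of R^n are columns 'cV[R]_n and covectors, i.e. elements of the dual
   space R^n*, are rows 'rV[R]_n; the pairing of p with v is p *m v. Below, V
   is one of these two spaces. *)

Section bodies.
Context {R : realType} {V : normedModType R}.
Implicit Types (A S U : set V) (g : V -> R) (p q u v : V).

Definition boundary A : set V := closure A `\` interior A.

Definition affine_line p u : set V := [set p + t *: u | t in [set: R]].

(* Convexity is required explicitly: a body is a convex body. *)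
Definition strictly_convex_body A : Prop :=
  [/\ compact A, convex_set A, interior A !=set0 &
      forall p u, u != 0 -> (boundary A `&` affine_line p u #<= `I_2)%card].

(* In finite dimension, continuity of x |-> 'd g x h for each fixed h is
   continuity of x |-> 'd g x. *)
Definition C1_submersion_on U g : Prop :=
  forall x, U x ->
    [/\ differentiable g x,
        exists h, 'd g x h != 0 &
        forall h, {for x, continuous (fun y => 'd g y h)}].

Definition local_equation S q U g : Prop :=
  [/\ open U, U q, C1_submersion_on U g &
      S `&` U = [set x | g x = 0] `&` U].

Definition C1_hypersurface S : Prop :=
  forall q, S q -> exists U g, local_equation S q U g.

(* The kernel of 'd g q does not depend on the chosen local equation g of S. *)
Definition tangent_hyperplane S q : set V :=
  [set v | exists U g, local_equation S q U g /\ 'd g q v = 0].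

Definition positively_homogeneous g : Prop :=
  forall (l : R) v, 0 < l -> g (l *: v) = l * g v.

Definition C1_strictly_convex_body A : Prop :=
  strictly_convex_body A /\ C1_hypersurface (boundary A).

(* g is the (possibly asymmetric) gauge of A; since A is bounded, it is
   determined by these two conditions. *)
Definition gauge_of A g : Prop :=
  positively_homogeneous g /\ A = [set v | g v <= 1].

End bodies.

(* Lebesgue integral over R^n, as an iterated integral over the coordinates;
   it is only used for bounded Borel functions of bounded support. *)
Fixpoint rV_integral {R : realType} (n : nat) : ('rV[R]_n -> R) -> R :=
  match n with
  | 0 => fun f => f 0
  | m.+1 => fun f =>
      (\int[@lebesgue_measure R]_x
         rV_integral (fun y : 'rV[R]_m => f (row_mx (x%:M : 'rV[R]_1) y)))%R
  end.

Definition barycentre {R : realType} (n : nat) (A : set 'rV[R]_n) : 'rV[R]_n :=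
  \row_i (rV_integral (fun x => \1_A x * x 0 i)
          / rV_integral (fun x => \1_A x : R)).

Section billiards.
Context {R : realType} {n : nat}.
Implicit Types (K : set 'cV[R]_n) (T : set 'rV[R]_n).
Implicit Types (F : 'cV[R]_n -> R) (Ft : 'rV[R]_n -> R).
Implicit Types (q v : 'cV[R]_n) (p : 'rV[R]_n).
Implicit Types (H : 'cV[R]_n -> 'End('cV[R]_n)).

Definition covector_diff F q : 'rV[R]_n := \row_i 'd F q (delta_mx i 0).

(* The differential of Ft at p, seen in R^n = (R^n* )^*. *)
Definition vector_diff Ft p : 'cV[R]_n := \col_i 'd Ft p (delta_mx 0 i).

Definition positive_multiple v1 v2 : Prop := exists2 c : R, 0 < c & v1 = c *: v2.

(* Only the values of H on the boundary of K are relevant. *)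
Definition projective_billiard K H : Prop :=
  forall q, boundary K q ->
    [/\ (H q \o H q = \1)%VF,
        passmx.leigenvalue (H q) 1,
        passmx.leigenvalue (H q) (-1) &
        [set v | v \in passmx.leigenspace (H q) 1]
          = tangent_hyperplane (boundary K) q].

Definition minkowski_reflection F T Ft q v_in v_out : Prop :=
  exists p1,
    [/\ boundary T p1,
        positive_multiple (vector_diff Ft p1) v_in &
        (exists p2, [/\ p2 != p1, boundary T p2,
                        affine_line p1 (covector_diff F q) p2 &
                        v_out = vector_diff Ft p2])
        \/ (tangent_hyperplane (boundary T) p1 (covector_diff F q)
            /\ v_out = v_in)].

Definition same_trajectories K F T Ft H : Prop :=
  forall q v_in, boundary K q -> 0 < 'd F q v_in ->
  forall v_out, minkowski_reflection F T Ft q v_in v_out ->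
    positive_multiple v_out (H q v_in).

(* The library's norm on 'rV[R]_n is the sup norm, hence the explicit sum. *)
Definition closed_euclidean_ball p (r : R) : set 'rV[R]_n :=
  [set x | \sum_i (x 0 i - p 0 i) ^+ 2 <= r ^+ 2].

Definition ellipsoid T : Prop :=
  exists (p : 'rV[R]_n) (r : R) (A : 'M[R]_n) (b : 'rV[R]_n),
    [/\ 0 < r, A \in unitmx &
        T = [set x *m A + b | x in closed_euclidean_ball p r]].

End billiards.

(* Main.v *)
(* A point q of the boundary of K enters only through its conormal, which may be
   prescribed up to a factor, so fix a covector f and let w span the (-1)-
   eigenspace of H_q, with f w = 1.  For an interior point x of T let x + a(x) f
   and x - s(x) f be the ends of the chord through x; a and s are concave, and
   the reflection law says that a and s - 2 w have a common supergradient at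
   every point.  They thus differ by a constant kappa, so that the affine
   reflection x |-> x + (kappa - 2 w(x)) f preserves T.
   Lift T to T x {1} in dimension n + 1, where these reflections become linear,
   and take the ellipsoid of least volume around it centred at 0 (a matrix L of
   maximal determinant): by its uniqueness the lifted reflections are orthogonal
   for it.  Any two points of equal norm in that metric are exchanged by one of
   them, so T is a union of level sets of a quadratic form, and by convexity T is
   an ellipsoid. *)

Require Import Defs.
From HB Require Import structures.
From mathcomp Require Import all_boot all_order all_algebra.
From mathcomp Require Import all_classical all_reals all_analysis.
From mathcomp Require Import ring lra.
Import Order.TTheory GRing.Theory Num.Theory.
Import numFieldNormedType.Exports.
Local Open Scope classical_set_scope.
Local Open Scope ring_scope.

Set Implicit Arguments.
Unset Strict Implicit.
Unset Printing Implicit Defensive.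

(** * Determinant-maximal contractions *)

Section dot_product.
Context {R : realType}.

Definition dot m (x y : 'rV[R]_m) : R := (x *m y^T) 0 0.

Lemma dotE m (x y : 'rV[R]_m) : dot x y = \sum_i x 0 i * y 0 i.
Proof. by rewrite /dot mxE; apply: eq_bigr => i _; rewrite mxE. Qed.

Lemma dotC m (x y : 'rV[R]_m) : dot x y = dot y x.
Proof. by rewrite !dotE; apply: eq_bigr => i _; rewrite mulrC. Qed.

Lemma dotDl m (x y z : 'rV[R]_m) : dot (x + y) z = dot x z + dot y z.
Proof. by rewrite /dot mulmxDl mxE. Qed.

Lemma dotDr m (x y z : 'rV[R]_m) : dot z (x + y) = dot z x + dot z y.
Proof. by rewrite dotC dotDl !(dotC z). Qed.

Lemma dotZl m a (x y : 'rV[R]_m) : dot (a *: x) y = a * dot x y.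
Proof. by rewrite /dot -scalemxAl mxE. Qed.

Lemma dotZr m a (x y : 'rV[R]_m) : dot x (a *: y) = a * dot x y.
Proof. by rewrite dotC dotZl dotC. Qed.

Lemma dotNl m (x y : 'rV[R]_m) : dot (- x) y = - dot x y.
Proof. by rewrite /dot mulNmx mxE. Qed.

Lemma dotNr m (x y : 'rV[R]_m) : dot x (- y) = - dot x y.
Proof. by rewrite dotC dotNl dotC. Qed.

Lemma dot0l m (x : 'rV[R]_m) : dot 0 x = 0.
Proof. by rewrite /dot mul0mx mxE. Qed.

Lemma dotvv_ge0 m (x : 'rV[R]_m) : 0 <= dot x x.
Proof. by rewrite dotE sumr_ge0// => i _; rewrite -expr2 sqr_ge0. Qed.

Lemma dotvv_eq0 m (x : 'rV[R]_m) : (dot x x == 0) = (x == 0).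
Proof.
apply/eqP/eqP => [|->]; last by rewrite dot0l.
rewrite dotE => /eqP; rewrite psumr_eq0 => [/allP h|i _]; last first.
  by rewrite -expr2 sqr_ge0.
apply/rowP => i; rewrite mxE.
by have /implyP/(_ isT) := h i (mem_index_enum _); rewrite mulf_eq0 orbb => /eqP.
Qed.

Lemma dotvv_gt0 m (x : 'rV[R]_m) : x != 0 -> 0 < dot x x.
Proof. by move=> x0; rewrite lt_def dotvv_eq0 x0 dotvv_ge0. Qed.

Lemma sqr_coord_le_dot m (x : 'rV[R]_m) i : x 0 i ^+ 2 <= dot x x.
Proof.
rewrite dotE (bigD1 i)//= -expr2 lerDl sumr_ge0// => j _.
by rewrite -expr2 sqr_ge0.
Qed.

Lemma dot_mulmx m k (x : 'rV[R]_m) (y : 'rV_k) (A : 'M[R]_(m, k)) :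
  dot (x *m A) y = dot x (y *m A^T).
Proof. by rewrite /dot trmx_mul trmxK mulmxA. Qed.

Lemma mul_rv_dot m k (x y : 'rV[R]_m) (z : 'rV_k) :
  x *m (y^T *m z) = dot x y *: z.
Proof. by rewrite mulmxA [x *m y^T]mx11_scalar mul_scalar_mx. Qed.

Lemma dot_row_mx m1 m2 (a c : 'rV[R]_m1) (b d : 'rV[R]_m2) :
  dot (row_mx a b) (row_mx c d) = dot a c + dot b d.
Proof. by rewrite /dot tr_row_mx mul_row_col mxE. Qed.

(** The matrix determinant lemma: conjugation by a unipotent block matrix turns a block triangular
    matrix with diagonal blocks [1%:M + c *m r] and [1] into one with diagonal blocks [1] and
    [1 + r *m c]. *)
Lemma det_id_add_rank1 m (c : 'cV[R]_m) (r : 'rV[R]_m) :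
  \det (1%:M + c *m r) = 1 + (r *m c) 0 0.
Proof.
have E : block_mx 1%:M 0 r 1%:M *m block_mx (1%:M + c *m r) c 0 1%:M
   *m block_mx 1%:M 0 (- r) 1%:M = block_mx 1%:M c 0 (1%:M + r *m c).
  rewrite !mulmx_block !mul1mx !mul0mx !mulmx0 !mulmx1 !addr0 !add0r.
  rewrite !mulmxDr !mulmxN mulmx1 mulmxDl mul1mx mulmxA.
  by rewrite addrK [r + _]addrC subrr [r *m c + _]addrC.
have := congr1 determinant E; rewrite !det_mulmx !det_lblock !det_ublock !det1.
by rewrite !mul1r !mulr1 => ->; rewrite det_mx11 !mxE.
Qed.

End dot_product.

(** * Centred ellipsoids of least volume and their symmetries *)

Section maximal_determinant.
Context {R : realType}.

Definition contracts m (P : set 'rV[R]_m) (L : 'M[R]_m) : Prop :=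
  forall x, P x -> dot (x *m L) (x *m L) <= 1.

(** The ellipsoid [dot (x *m L) (x *m L) <= 1] has volume proportional to the inverse of [|\det L|],
    so it is a least-volume ellipsoid among those centred at 0 and containing [P]. *)
Definition max_contraction m (P : set 'rV[R]_m) (L : 'M[R]_m) : Prop :=
  [/\ L \in unitmx, contracts P L &
      forall L', contracts P L' -> `|\det L'| <= `|\det L|].

Lemma sum_continuous (T : topologicalType) I (r : seq I) (f : I -> T -> R) :
  (forall i, continuous (f i)) -> continuous (fun x => \sum_(i <- r) f i x).
Proof.
by move=> h; apply: continuous_big => // -[a b]; exact: add_continuous.
Qed.

Lemma prod_continuous (T : topologicalType) I (r : seq I) (f : I -> T -> R) :
  (forall i, continuous (f i)) -> continuous (fun x => \prod_(i <- r) f i x).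
Proof.
by move=> h; apply: continuous_big => // -[a b]; exact: mul_continuous.
Qed.

Lemma fun_mul_continuous (T : topologicalType) (f g : T -> R) :
  continuous f -> continuous g -> continuous (fun x => f x * g x).
Proof. by move=> cf cg x; apply: (continuousM (cf x) (cg x)). Qed.

Lemma vec_mx_coord_continuous m k (i : 'I_m) (j : 'I_k) :
  continuous (fun v : 'rV[R]_(m * k) => vec_mx v i j).
Proof.
have -> : (fun v : 'rV[R]_(m * k) => vec_mx v i j)
    = (fun v => v 0 (mxvec_index i j)) by apply/funext => v; rewrite mxE.
exact: coord_continuous.
Qed.

Lemma det_vec_mx_continuous m :
  continuous (fun v : 'rV[R]_(m * m) => \det (vec_mx v)).
Proof.
rewrite /determinant; apply: sum_continuous => s.
apply: fun_mul_continuous; first exact: cst_continuous.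
by apply: prod_continuous => i; exact: vec_mx_coord_continuous.
Qed.

Lemma dot_vec_mx_continuous m (x : 'rV[R]_m) :
  continuous (fun v : 'rV[R]_(m * m) => dot (x *m vec_mx v) (x *m vec_mx v)).
Proof.
have c i : continuous (fun v : 'rV[R]_(m * m) => (x *m vec_mx v) 0 i).
  under eq_fun do rewrite mxE.
  apply: sum_continuous => j; apply: fun_mul_continuous; first exact: cst_continuous.
  exact: vec_mx_coord_continuous.
under eq_fun do rewrite dotE.
by apply: sum_continuous => i; apply: fun_mul_continuous; exact: c.
Qed.

(** The contractions of [P] form a closed set, bounded because the rows of [E] are a basis inside
    [P], so the determinant attains its maximal modulus; this is nonzero since a small scalar matrix
    is a contraction. *)
Lemma max_contraction_exists m (P : set 'rV[R]_m) (E : 'M[R]_m) (M : R) :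
  E \in unitmx -> (forall i, P (row i E)) -> (forall x, P x -> dot x x <= M) ->
  exists L, max_contraction P L.
Proof.
move=> Eu EP PM.
pose F := [set v : 'rV[R]_(m * m) | contracts P (vec_mx v)].
have Fcl : closed F.
  have -> : F = \bigcap_(x in P) ((fun v : 'rV[R]_(m * m) =>
      dot (x *m vec_mx v) (x *m vec_mx v)) @^-1` [set t | t <= 1]).
    by [].
  apply: closed_bigI => x Px; apply: closed_comp; last exact: closed_le.
  by move=> v _; exact: dot_vec_mx_continuous.
(* A contraction [L] equals [invmx E *m (E *m L)], and the entries of [E *m L] are at most 1 in
   absolute value. *)
pose B := \sum_i \sum_j `|invmx E i j|.
have Fb : F `<=` [set v | forall k, v ord0 k \in `[- B, B]].
  move=> v Fv k; case/mxvec_indexP: k => i j.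
  have -> : v ord0 (mxvec_index i j) = vec_mx v i j by rewrite mxE.
  rewrite in_itv /= -ler_norml -[vec_mx v](mulKmx Eu) mxE.
  apply: le_trans (ler_norm_sum _ _ _) _.
  rewrite [leRHS](bigD1 i)//= ler_wpDr//.
    by rewrite sumr_ge0// => a _; rewrite sumr_ge0.
  apply: ler_sum => k _; rewrite normrM ler_piMr//.
  have := Fv _ (EP k); rewrite -row_mul => /(le_trans (sqr_coord_le_dot _ j)).
  by rewrite !mxE -real_normK ?num_real// expr_le1.
have Fc : compact F.
  apply: subclosed_compact Fcl _ Fb.
  apply: (@rV_compact R (m * m) (fun=> `[- B, B]%classic)) => _.
  exact: segment_compact.
have [a a0 Fa] : exists2 a : R, a > 0 & contracts P a%:M.
  exists (1 + `|M|)^-1 => [|x Px]; first by rewrite invr_gt0 ltr_pwDl.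
  have M0 : 0 < 1 + `|M| by rewrite ltr_pwDl.
  rewrite mul_mx_scalar dotZl dotZr mulrA -invfM ler_pdivrMl ?mulr_gt0// mulr1.
  apply: le_trans (PM _ Px) _; apply: le_trans (ler_norm M) _.
  by have := normr_ge0 M; nra.
have F0 : F !=set0 by exists (mxvec a%:M); rewrite /F /= mxvecK.
have dc : {within F, continuous (fun v : 'rV[R]_(m * m) => `|\det (vec_mx v)|)}.
  apply: continuous_subspaceT => v.
  exact: (continuous_comp (@det_vec_mx_continuous m v) (@norm_continuous _ R _)).
have [v vF vmax] := compact_EVT_max F0 Fc dc.
have vm L : contracts P L -> `|\det L| <= `|\det (vec_mx v)|.
  by move=> PL; have := vmax (mxvec L); rewrite mxvecK; apply; rewrite inE /F /= mxvecK.
exists (vec_mx v); split => //; last by rewrite inE in vF.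
have := vm _ Fa; rewrite det_scalar unitmxE unitfE -normr_gt0; apply: lt_le_trans.
by rewrite normr_gt0 expf_neq0// gt_eqF.
Qed.

(* With [x *m L = y] and [g *m L = h], the image of y under the reflection is
   [y - 2 * (dot y h / dot h h) *: h + dot y d *: h], where
   [d = (invmx L *m om)^T + 2 / dot h h *: h] is orthogonal to h.  If d were
   nonzero, averaging the forms of L and of its reflection would leave room for
   the larger form of [L *m (1 + e^T h) *m (1 + s e^T e)], [e = - d / 2]. *)
Lemma max_contraction_reflection m (P : set 'rV[R]_m) L (om : 'cV_m) (g : 'rV_m) :
  max_contraction P L -> g != 0 -> g *m om = (- 2)%:M ->
  (forall x, P x -> P (x + x *m om *m g)) ->
  forall x, P x -> x *m om *m g =
    - (2 * dot (x *m L) (g *m L) / dot (g *m L) (g *m L)) *: g.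
Proof.
move=> [Lu LP Lmax] g0 gom refl.
set h := g *m L; pose c := dot h h.
have h0 : h != 0 by apply: contra_neq g0 => h0; rewrite -[g](mulmxK Lu) -/h h0 mul0mx.
have c0 : 0 < c by apply: dotvv_gt0.
pose o := (invmx L *m om)^T.
have omE x : x *m om = (dot (x *m L) o)%:M.
  by rewrite /dot trmxK mulmxA mulmxK// -mx11_scalar.
have ho : dot h o = - 2.
  by have := gom; rewrite omE -/h => /(congr1 (fun A : 'M[R]_1 => A 0 0)); rewrite !mxE.
pose e := (- 2^-1) *: o + (- c^-1) *: h.
have he : dot h e = 0.
  by rewrite /e dotDr !dotZr ho -/c (mulNr _ c) mulVf ?gt_eqF//; lra.
have oE : o = (- 2) *: e + (- (2 / c)) *: h.
  rewrite /e scalerDr !scalerA mulrNN divff ?pnatr_eq0// scale1r.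
  by rewrite -addrA -scalerDl mulrNN addrN scale0r addr0.
clearbody e.
suff e0 : e = 0.
  move=> x Px; rewrite omE mul_scalar_mx oE e0 scaler0 add0r dotZr.
  by congr (_ *: _); rewrite /c; ring.
apply/eqP; case: (eqVneq e 0) => // e0; exfalso.
pose D := dot e e; have D0 : 0 < D by apply: dotvv_gt0.
(* Any [s > 0] with [2 * s + s ^+ 2 * D <= c] would do; this one has [s * D <= 1] and
   [3 * s <= c]. *)
pose s := c / (3 + c * D).
have q0 : 0 < 3 + c * D by rewrite addr_gt0// mulr_gt0.
have s0 : 0 < s by rewrite divr_gt0.
have sE : s * 3 + s * (c * D) = c by rewrite -mulrDr divfK ?gt_eqF.
have sle : 2 * s + s ^+ 2 * D <= c.
  suff : s * D <= 1 by have := mulr_gt0 s0 D0; nra.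
  have : s * D * c <= 1 * c by have := mulr_gt0 s0 c0; rewrite mul1r; nra.
  by rewrite ler_pM2r.
pose U := (1%:M + e^T *m h) *m (1%:M + (s *: e)^T *m e).
(* With [b = dot y e], the squared length of [y *m U] is the mean of those of [y] and of its
   reflection, both at most 1, minus [(c - (2 * s + s ^+ 2 * D)) * b ^+ 2]. *)
have LU : contracts P (L *m U).
  move=> x Px; rewrite mulmxA.
  set y := x *m L.
  have H1 : dot y y <= 1 := LP _ Px.
  have := LP _ (refl _ Px).
  rewrite mulmxDl -/y omE -/y mul_scalar_mx -scalemxAl -/h.
  rewrite !(dotDl, dotDr, dotZl, dotZr) -/c (dotC h y).
  have -> : dot y o = - 2 * dot y e - 2 / c * dot y h.
    by rewrite {1}oE dotDr !dotZr (mulNr (2 / c)).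
  rewrite /U mulmxA mulmxDr mulmx1 mul_rv_dot.
  rewrite mulmxDr mulmx1 mul_rv_dot.
rewrite !(dotDl, dotDr, dotZl, dotZr) -/c -/D (dotC h y) ?(dotC e h) !he ?(dotC e y).
  set a := dot y h; set b := dot y e; set y2 := dot y y in H1 *.
  have cK : c * (2 / c * a) = 2 * a by field; rewrite gt_eqF.
  set k := 2 / c * a in cK *.
  move=> H2.
  have : 0 <= (c - (2 * s + s ^+ 2 * D)) * b ^+ 2.
    by rewrite mulr_ge0 ?sqr_ge0// subr_ge0.
  have aE : a = c * k / 2 by rewrite cK; field.
  by move: H1 H2; rewrite aE; lra.
(* Since [h] and [e] are orthogonal, the first factor of [U] has determinant 1; the second has
   [1 + s * D > 1], against maximality. *)
have := Lmax _ LU; rewrite det_mulmx normrM ger_pMr; last first.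
  by rewrite normr_gt0 -unitfE -unitmxE.
rewrite /U det_mulmx !det_id_add_rank1 -[X in 1 + X]/(dot h e).
rewrite he addr0 mul1r -/(dot e (s *: e)) dotZr -/D ger0_norm ?addr_ge0//; last first.
  by rewrite mulr_ge0// ltW.
by rewrite leNgt ltrDl mulr_gt0.
Qed.

End maximal_determinant.

(** * Sets with a reflection in every direction *)

Section reflections.
Context {R : realType}.

(** Unless [a = b], this is the Householder reflection in the hyperplane orthogonal to [a - b]. *)
Lemma orthogonal_map_exists m (a b : 'rV[R]_m) : dot a a = 1 -> dot b b = 1 ->
  exists O : 'M[R]_m, [/\ O^T = O, O *m O^T = 1%:M & a *m O = b].
Proof.
move=> a1 b1; case: (eqVneq a b) => [->|ab].
  by exists 1%:M; rewrite trmx1 !mulmx1.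
pose u := a - b; have u0 : 0 < dot u u by rewrite dotvv_gt0// subr_eq0.
have uE : dot u u = 2 * (1 - dot a b).
  rewrite /u dotDl !dotDr !dotNl !dotNr a1 b1 (dotC b a); ring.
pose k := 2 / dot u u; have kE : k * dot u u = 2 by rewrite divfK ?gt_eqF.
pose O : 'M[R]_m := 1%:M - k *: (u^T *m u).
have OT : O^T = O.
  by rewrite /O linearB /= trmx1 linearZ /= trmx_mul trmxK.
have OE (x : 'rV_m) : x *m O = x - (k * dot x u) *: u.
  by rewrite mulmxBr mulmx1 -scalemxAr mul_rv_dot scalerA.
exists O; split => //.
  rewrite OT; apply/row_matrixP => i; rewrite row_mul row1 rowE !OE.
  set y := delta_mx 0 i; rewrite -addrA -opprD -scalerDl dotDl dotNl dotZl.
  rewrite (_ : k * dot y u + _ = 0) ?scale0r ?subr0//.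
  by rewrite mulrBr (mulrCA k) kE; ring.
have -> : a *m O = a - u.
  rewrite OE; suff -> : k * dot a u = 1 by rewrite scale1r.
  rewrite -[RHS](divff (lt0r_neq0 u0)) /k mulrAC; congr (_ / _).
  by rewrite uE /u dotDr dotNr a1; ring.
by rewrite /u opprB addrC subrK.
Qed.

(** The rows of this matrix are the lifts to height 1 of the points [r *: delta_mx 0 i] and of 0:
    they show that the lift of [T] spans. *)
Lemma det_augmented n (r : R) :
  0 < r -> block_mx (r%:M : 'M[R]_n) (const_mx 1) 0 (1%:M : 'M[R]_1) \in unitmx.
Proof.
move=> r0; rewrite unitmxE det_ublock det1 mulr1 det_scalar unitfE.
by rewrite expf_neq0// gt_eqF.
Qed.

Definition lift1 n (x : 'rV[R]_n) : 'rV[R]_(n + 1) := row_mx x 1%:M.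

(** The map is the oblique affine reflection that reverses [f] and fixes the hyperplane
    [2 * w(x) = kappa]. *)
Definition symmetric_along n (T : set 'rV[R]_n) (f : 'rV[R]_n) : Prop :=
  exists (w : 'cV[R]_n) (kappa : R), f *m w = 1%:M /\
    forall x, T x -> T (x + (kappa - 2 * (x *m w) 0 0) *: f).

(** If [x] and [y] are on one level of the lifted form, the symmetry of [T] along [y - x] sends [x]
    to [y]: its lift is orthogonal for the form at points of [T], and [y] is where the orthogonal
    reflection along [y - x] takes [x]. *)
Lemma level_sets_form n (T : set 'rV[R]_n) (r M : R) :
  0 < r -> (forall x, T x -> dot x x <= M) -> T 0 ->
  (forall i, T (r *: delta_mx 0 i)) ->
  (forall f, f != 0 -> symmetric_along T f) ->
  exists2 L : 'M[R]_(n + 1), L \in unitmx & forall x y, T x ->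
    dot (lift1 y *m L) (lift1 y *m L) = dot (lift1 x *m L) (lift1 x *m L) -> T y.
Proof.
move=> r0 TM T0 Tr Tsym.
pose P := [set lift1 x | x in T].
have [||L Lmax] := @max_contraction_exists R (n + 1) P _ (M + 1) (det_augmented n r0).
- move=> i; rewrite -(splitK i) /block_mx; case: (fintype.split i) => j /=.
    exists (r *: delta_mx 0 j) => //; rewrite rowKu row_row_mx /lift1.
    rewrite -(scalemx1 _ r) linearZ /= row1; congr row_mx.
    by apply/rowP => k; rewrite !mxE (ord1 k).
  exists 0 => //; rewrite rowKd row_row_mx /lift1 (ord1 j); congr row_mx.
    by apply/rowP => k; rewrite !mxE.
  by apply/rowP => k; rewrite !mxE (ord1 k).
- by move=> _ [x Tx <-]; rewrite /lift1 dot_row_mx lerD ?TM// /dot trmx1 mulmx1 mxE.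
have Lu : L \in unitmx by case: Lmax.
exists L => // x y Tx xy.
have [->//|yx] := eqVneq y x.
have f0 : y - x != 0 by rewrite subr_eq0.
have [w [kappa [fw Tw]]] := Tsym _ f0.
pose g : 'rV[R]_(n + 1) := row_mx (y - x) 0.
pose om : 'cV[R]_(n + 1) := col_mx (- 2 *: w) kappa%:M.
have g0 : g != 0.
  by apply: contra_neq f0 => /(congr1 lsubmx); rewrite row_mxKl linear0.
have omE z : lift1 z *m om = (kappa - 2 * (z *m w) 0 0)%:M.
  rewrite [LHS]mx11_scalar; congr (_%:M).
  rewrite /lift1 mul_row_col mul1mx -scalemxAr; set zw := z *m w.
  by rewrite !mxE mulr1n addrC mulNr.
have step z : lift1 z + lift1 z *m om *m g
    = lift1 (z + (kappa - 2 * (z *m w) 0 0) *: (y - x)).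
  by rewrite omE mul_scalar_mx /lift1 /g scale_row_mx add_row_mx scaler0 addr0.
have gom : g *m om = (- 2)%:M.
  by rewrite /g mul_row_col mul0mx addr0 -scalemxAr fw scalemx1.
have lP z : P z -> P (z + z *m om *m g).
  by move=> [t Tt <-]; rewrite step; exists (t + (kappa - 2 * (t *m w) 0 0) *: (y - x)) => //; exact: Tw.
have := max_contraction_reflection Lmax g0 gom lP (ex_intro2 _ _ x Tx erefl).
have gE : lift1 y = lift1 x + g.
  by rewrite /lift1 /g add_row_mx addr0 addrC subrK.
move: xy; rewrite gE mulmxDl.
set Y := lift1 x *m L; set G := g *m L => xy.
have G0 : 0 < dot G G.
  by rewrite dotvv_gt0//; apply: contra_neq g0 => G0; rewrite -[g](mulmxK Lu) -/G G0 mul0mx.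
(* Equality of the levels reads [2 * dot Y G + dot G G = 0], so the reflection moves [lift1 x] by
   exactly [g]. *)
have -> : - (2 * dot Y G / dot G G) = 1.
  move: xy; rewrite dotDl !dotDr (dotC G Y) => xy.
  have -> : 2 * dot Y G = - dot G G by lra.
  by rewrite mulNr divff ?opprK// gt_eqF.
rewrite scale1r omE mul_scalar_mx => gk.
have := Tw _ Tx; suff -> : (kappa - 2 * (x *m w) 0 0) *: (y - x) = y - x.
  by rewrite addrC subrK.
by move: gk; rewrite /g scale_row_mx => /eq_row_mx[].
Qed.

Lemma dotvv_continuous n : continuous (fun x : 'rV[R]_n => dot x x).
Proof.
under eq_fun do rewrite dotE.
by apply: sum_continuous => i; apply: fun_mul_continuous; exact: coord_continuous.
Qed.

(** By compactness there is a highest level [M] on [T], and [T] contains that whole level set.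
    Convexity fills its inside, as every inner point is on a segment between two antipodal points of
    the level. *)
Lemma level_sets_ellipsoid n (T : set 'rV[R]_n) (C : 'M[R]_n) (l : 'rV[R]_n) x0 :
  C \in unitmx -> compact T -> T 0 -> x0 != 0 -> T x0 ->
  (forall x y t, T x -> T y -> 0 <= t <= 1 -> T (t *: x + (1 - t) *: y)) ->
  (forall x y, T x ->
    dot (y *m C + l) (y *m C + l) = dot (x *m C + l) (x *m C + l) -> T y) ->
  ellipsoid T.
Proof.
move=> Cu Tc T0 x0n Tx0 Tcvx Tlev.
pose phi x := x *m C + l; pose psi y := (y - l) *m invmx C.
have phiK x : psi (phi x) = x by rewrite /psi /phi addrK mulmxK.
have psiK y : phi (psi y) = y by rewrite /psi /phi mulmxKV// subrK.
have pc : {within T, continuous (fun x => dot (phi x) (phi x))}.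
  apply: continuous_subspaceT.
  have c i : continuous (fun x => phi x 0 i).
    rewrite /phi; under eq_fun do rewrite !mxE.
    have h : continuous (fun x : 'rV[R]_n => \sum_j x 0 j * C j i).
      apply: sum_continuous => j; apply: fun_mul_continuous.
        exact: coord_continuous.
      exact: cst_continuous.
    by move=> x; apply: (cvgD (h x) (cvg_cst _)).
  under eq_fun do rewrite dotE.
  by apply: sum_continuous => i; apply: fun_mul_continuous; exact: c.
have [x1 + x1max] := compact_EVT_max (ex_intro _ _ T0) Tc pc.
rewrite inE => Tx1; pose M := dot (phi x1) (phi x1).
have leM x : T x -> dot (phi x) (phi x) <= M by move=> Tx; apply: x1max; rewrite inE.
have M0 : 0 < M.
  rewrite lt_neqAle dotvv_ge0 andbT eq_sym; apply: contra x0n => /eqP M0.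
  have z x : T x -> x = psi 0.
    move=> Tx; rewrite -[x in LHS]phiK; congr psi; apply/eqP.
    by rewrite -dotvv_eq0 eq_le dotvv_ge0 andbT -M0 leM.
  by rewrite (z _ Tx0) -(z _ T0).
have TE : T = [set x | dot (phi x) (phi x) <= M].
  apply/seteqP; split => [x /leM//|x /= xM].
  (* Here [phi x = k *: e] with [e] on the top level and [0 <= k <= 1], which is the mean of [e] and
     [- e] with weight [t = (1 + k) / 2] on [e]; at the centre any [e] serves, with [t = 1 / 2]. *)
  have [e [t [eM t1 xe]]] : exists e t,
      [/\ dot e e = M, 0 <= t <= 1 & phi x = (t - (1 - t)) *: e].
    have [->|px0] := eqVneq (phi x) 0.
      exists (phi x1), 2^-1; split => //; first by apply/andP; split; lra.
      by rewrite (_ : _ - _ = 0) ?scale0r//; field.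
    have m0 := dotvv_gt0 px0; set m := dot _ _ in xM m0.
    pose k := Num.sqrt (m / M).
    have k0 : 0 < k by rewrite sqrtr_gt0 divr_gt0.
    have kE : k ^+ 2 = m / M by rewrite sqr_sqrtr// divr_ge0 ?ltW.
    have k1 : k <= 1.
      have : k ^+ 2 <= 1 by rewrite kE ler_pdivrMr// mul1r.
      by rewrite expr_le1// ltW.
    exists (k^-1 *: phi x), ((1 + k) / 2); split.
    - rewrite dotZl dotZr mulrA -invfM -expr2 kE -/m invf_div divfK// gt_eqF//.
    - by apply/andP; split; lra.
    - rewrite scalerA (_ : _ - _ = k); last by field.
      by rewrite divff ?scale1r// gt_eqF.
  have Te s : s ^+ 2 = 1 -> T (psi (s *: e)).
    move=> s1; apply: Tlev Tx1 _; rewrite -/(phi _) -/(phi _) psiK.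
    by rewrite dotZl dotZr mulrA -expr2 s1 mul1r.
  have := Tcvx _ _ t (Te 1 (expr1n _ _)) (Te (- 1) (etrans (sqrrN 1) (expr1n _ 2))) t1.
  suff -> : t *: psi (1 *: e) + (1 - t) *: psi (-1 *: e) = x by [].
  rewrite -[RHS]phiK xe /psi !scalemxAl -mulmxDl; congr (_ *m _).
  rewrite scale1r scaleN1r !scalerBr addrACA -opprD -scalerDl (addrC t) subrK.
  by rewrite scale1r scalerN -scalerBl.
exists 0, (Num.sqrt M), (invmx C), (- l *m invmx C); split.
- by rewrite sqrtr_gt0.
- by rewrite unitmx_inv.
have bE : closed_euclidean_ball 0 (Num.sqrt M) = [set y : 'rV[R]_n | dot y y <= M].
  apply/funext => y; rewrite /closed_euclidean_ball /mkset sqr_sqrtr ?(ltW M0)// dotE.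
  by under eq_bigr do rewrite mxE subr0 expr2.
rewrite bE TE; apply/seteqP; split => [x /= xM|_ /= [y yM <-]].
  by exists (phi x) => //; rewrite -mulmxDl; exact: phiK.
by rewrite -mulmxDl -/(psi y) psiK.
Qed.

(** The form lives in dimension n + 1 and has to be restricted to height 1. Multiplying [L] by an
    orthogonal matrix leaves the form unchanged and can clear the upper right block; the form at
    [lift1 x] is then a squared length of an affine function of [x] plus a constant. *)
Lemma reflections_ellipsoid n (T : set 'rV[R]_n) (r : R) : (0 < n)%N ->
  compact T ->
  (forall x y t, T x -> T y -> 0 <= t <= 1 -> T (t *: x + (1 - t) *: y)) ->
  0 < r -> T 0 ->
  (forall i, T (r *: delta_mx 0 i)) ->
  (forall f, f != 0 -> symmetric_along T f) ->
  ellipsoid T.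
Proof.
move=> n0 Tc Tcvx r0 T0 Tr Tsym.
have [a _ amax] := compact_EVT_max (ex_intro _ _ T0) Tc
  (continuous_subspaceT (@dotvv_continuous n)).
have TM x : T x -> dot x x <= dot a a by move=> Tx; apply: amax; rewrite inE.
have [L Lu Llev] := level_sets_form r0 TM T0 Tr Tsym.
pose e : 'rV[R]_(n + 1) := row_mx 0 1%:M.
pose z := e *m invmx L^T.
have e0 : e != 0.
  apply/eqP => /(congr1 (fun A : 'rV[R]_(n + 1) => A 0 (rshift n 0))).
  by rewrite row_mxEr !mxE => /eqP; rewrite oner_eq0.
have Ltu : L^T \in unitmx by rewrite unitmx_tr.
have z0 : z != 0 by apply: contra_neq e0 => z0; rewrite -[e](mulmxKV Ltu) -/z z0 mul0mx.
have zz := dotvv_gt0 z0; pose k := Num.sqrt (dot z z).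
have k0 : 0 < k by rewrite sqrtr_gt0.
have kE : k ^+ 2 = dot z z by rewrite sqr_sqrtr// ltW.
have e1 : dot e e = 1 by rewrite dot_row_mx dot0l add0r /dot trmx1 mulmx1 mxE.
have zk1 : dot (k^-1 *: z) (k^-1 *: z) = 1.
  by rewrite dotZl dotZr mulrA -invfM -expr2 kE mulVf// gt_eqF.
(* As [z *m L^T = e], sending [e] to the direction of [z] makes [e] an eigenvector of [L'^T]: the
   last column of [L'] is zero except at the bottom. *)
have [Q [QT QQ eQ]] := orthogonal_map_exists e1 zk1.
pose L' := L *m Q.
have Le : e *m L'^T = k^-1 *: e.
  by rewrite /L' trmx_mul QT mulmxA eQ -scalemxAl /z mulmxKV.
have LE : L' = block_mx (ulsubmx L') 0 (dlsubmx L') (drsubmx L').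
  rewrite -[LHS]submxK; congr (block_mx _ _ _ _).
  apply/trmx_inj; move: Le; rewrite -[in LHS](submxK L') tr_block_mx mul_row_block.
  by rewrite !mul0mx !mul1mx !add0r scale_row_mx scaler0 => /eq_row_mx[-> _]; rewrite trmx0.
have Cu : ulsubmx L' \in unitmx.
  have : \det L' \is a GRing.unit.
    by rewrite -unitmxE unitmx_mul Lu; case: (mulmx1_unit QQ).
  by rewrite {1}LE det_lblock unitrM -unitmxE => /andP[].
have form x : dot (lift1 x *m L) (lift1 x *m L) =
    dot (x *m ulsubmx L' + dlsubmx L') (x *m ulsubmx L' + dlsubmx L')
      + dot (drsubmx L') (drsubmx L').
  have -> : dot (lift1 x *m L) (lift1 x *m L)
      = dot (lift1 x *m L') (lift1 x *m L').
    by rewrite /L' mulmxA [RHS]dot_mulmx -[_ *m Q *m Q^T]mulmxA QQ mulmx1.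
  by rewrite LE /lift1 mul_row_block mulmx0 add0r !mul1mx dot_row_mx
             block_mxKul block_mxKdl block_mxKdr.
pose i0 : 'I_n := Ordinal n0.
apply: (@level_sets_ellipsoid n T _ (dlsubmx L') (r *: delta_mx 0 i0) Cu) => //.
  rewrite scaler_eq0 gt_eqF//=; apply/eqP.
  move=> /(congr1 (fun A : 'rV[R]_n => A 0 i0)).
  by rewrite !mxE !eqxx => /eqP; rewrite oner_eq0.
move=> x y Tx xy; apply: Llev Tx _; by rewrite !form xy.
Qed.

End reflections.

(** * Gauges of smooth convex bodies *)

Section differentials.
Context {R : realType} {V : normedModType R}.
Implicit Types (g : V -> R) (x h : V).

Lemma nbhs_norm_ex x (P : set V) :
  nbhs x P <-> exists2 r : R, 0 < r & forall v, `|v| < r -> P (x + v).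
Proof.
split => [/nbhs_normP[r /= r0 h]|[r r0 h]].
  exists r => // v vr; apply: h => /=.
  by rewrite opprD addNKr normrN.
apply/nbhs_normP; exists r => // y /= xy; rewrite -[y](subrK x) addrC.
by apply: h; rewrite distrC.
Qed.

Lemma diff_approx g x : differentiable g x -> forall e : R, 0 < e ->
  exists2 d : R, 0 < d & forall h, `|h| < d ->
    `|g (x + h) - g x - 'd g x h| <= e * `|h|.
Proof.
move=> /diff_locally dg e e0.
have /eqaddoP/(_ e e0)/(nbhs_norm_ex (0 : V))[d d0 H] := dg.
exists d => // h /H; rewrite add0r.
by rewrite (addrC x) -(addrA (g _)) -opprD.
Qed.

Lemma approx_diff g x (D : {linear V -> R}) : continuous D ->
  (forall e : R, 0 < e -> exists2 d : R, 0 < d &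
     forall h, `|h| < d -> `|g (x + h) - g x - D h| <= e * `|h|) ->
  differentiable g x /\ 'd g x = D :> (V -> R).
Proof.
move=> cD H.
have E : g \o shift x = cst (g x) + D +o_0 id.
  apply/eqaddoP => e e0; have [d d0 Hd] := H _ e0.
  apply/nbhs_norm_ex; exists d => // v vd; rewrite add0r.
  by have := Hd _ vd; rewrite (addrC x) -(addrA (g _)) -opprD.
have dE := diff_unique cD E.
split; last by rewrite dE.
by apply/diff_locallyP; rewrite dE.
Qed.

End differentials.

(** On a segment cut into equal steps, the supergradient inequalities at both ends of a step bound
    the change of [a - b] by the step length times the drop of the slope. The drops telescope, so
    the total change is at most a constant over the number of steps. *)
Lemma common_supergradient (R : realType) (V : normedModType R) (D : set V)
    (a b : V -> R) :
  (forall x y t, D x -> D y -> 0 <= t <= 1 -> D (x + t *: (y - x))) ->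
  (forall p, D p -> exists eta : {linear V -> R}, forall x, D x ->
     a x <= a p + eta (x - p) /\ b x <= b p + eta (x - p)) ->
  forall x y, D x -> D y -> a x - b x = a y - b y.
Proof.
move=> Dcvx super x y Dx Dy.
pose z t := x + t *: (y - x).
have Dz t : 0 <= t <= 1 -> D (z t) by exact: Dcvx.
(* [m s] is the slope along the segment of a common supergradient at time [s], with default 0
   outside the unit interval. *)
have /choice[m mP] s : exists m : R, 0 <= s <= 1 -> forall t, 0 <= t <= 1 ->
    a (z t) <= a (z s) + (t - s) * m /\ b (z t) <= b (z s) + (t - s) * m.
  have [s01|s01] := boolP (0 <= s <= 1); last by exists 0.
  have [eta etaP] := super _ (Dz _ s01); exists (eta (y - x)) => _ t t01.
  have := etaP _ (Dz _ t01).
  rewrite (_ : z t - z s = (t - s) *: (y - x)); last first.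
    by rewrite /z opprD addrACA subrr add0r -scalerBl.
  by rewrite linearZ.
pose f t := a (z t) - b (z t).
have fstep s t : 0 <= s -> s <= t -> t <= 1 ->
    `|f t - f s| <= (t - s) * (m s - m t).
  move=> s0 st t1.
  have s01 : 0 <= s <= 1 by rewrite s0 (le_trans st).
  have t01 : 0 <= t <= 1 by rewrite t1 (le_trans s0).
  have [h1 h2] := mP _ s01 _ t01; have [h3 h4] := mP _ t01 _ s01.
  by rewrite /f ler_norml; apply/andP; split; lra.
have fN N k : (k <= N.+1)%N ->
    `|f (k%:R / N.+1%:R) - f 0| <= (m 0 - m (k%:R / N.+1%:R)) / N.+1%:R.
  elim: k => [|k IH] kN; first by rewrite mul0r subrr normr0 subrr mul0r.
  have := IH (ltnW kN); set u := k%:R / _; set v := k.+1%:R / _ => h1.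
  have N0 : 0 < N.+1%:R :> R by rewrite ltr0n.
  have uv : v - u = N.+1%:R^-1.
    by rewrite /u /v -mulrBl -natrB// subSnn mul1r.
  have := fstep u v; rewrite divr_ge0// -subr_ge0 uv invr_ge0 ler0n.
  rewrite ler_pdivrMr// mul1r ler_nat kN => /(_ isT isT isT) h2.
  have -> : f v - f 0 = (f v - f u) + (f u - f 0) by rewrite addrA subrK.
  rewrite (le_trans (ler_normD _ _))// (le_trans (lerD h2 h1))//.
  by rewrite le_eqVlt; apply/orP; left; apply/eqP; ring.
suff f01 : f 1 = f 0.
  by move: f01; rewrite /f /z scale1r scale0r addr0 (addrC x) subrK => ->.
apply/eqP; rewrite -subr_eq0 -normr_le0 leNgt; apply/negP => d0.
set d := `|_| in d0.
pose N := Num.truncn ((m 0 - m 1) / d).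
have := fN N N.+1 (leqnn _); rewrite divff ?pnatr_eq0// -/d.
rewrite ler_pdivlMr ?ltr0n// mulrC -ler_pdivlMr// leNgt.
by rewrite truncnS_gt.
Qed.

Lemma convex_set_comb (R : realType) (V : normedModType R) (A : set V) :
  convex_set A -> forall x y (t : R),
  A x -> A y -> 0 <= t <= 1 -> A (t *: x + (1 - t) *: y).
Proof.
move=> Acvx x y t Ax Ay /andP[t0 t1].
by have := Acvx x y (Itv01 t0 t1); rewrite !inE; apply.
Qed.

Section gauges.
Context {R : realType} {V : normedModType R} (A : set V) (g : V -> R).
Context (A_compact : compact A) (A_convex : convex_set A).
Context (A_int : interior A !=set0) (A_gauge : gauge_of A g).

Lemma gauge_le1 v : A v = (g v <= 1) :> Prop.
Proof. by rewrite A_gauge.2. Qed.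

Lemma gauge0 : g 0 = 0.
Proof.
have := A_gauge.1 2 0 (ltr0n _ 2); rewrite scaler0 => h.
by apply/eqP; rewrite -(inj_eq (addrI (g 0))) addr0 -mulr2n -mulr_natl -h.
Qed.

Lemma gaugeZ (l : R) v : 0 <= l -> g (l *: v) = l * g v.
Proof.
rewrite le_eqVlt => /predU1P[<-|l0]; first by rewrite scale0r gauge0 mul0r.
exact: A_gauge.1.
Qed.

Lemma gauge_gt0 v : v != 0 -> 0 < g v.
Proof.
move=> v0; rewrite ltNge; apply/negP => gv.
have [M [_ /(_ (`|M| + 1))]] := compact_bounded A_compact.
rewrite (le_lt_trans (ler_norm _))// ?ltrDl// => /(_ isT) AM.
have nv : 0 < `|v| by rewrite normr_gt0.
have k0 : 0 < (`|M| + 2) / `|v| by rewrite divr_gt0// ltr_wpDl.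
have : A (((`|M| + 2) / `|v|) *: v).
  by rewrite gauge_le1 gaugeZ ?(ltW k0)// (le_trans _ ler01)// pmulr_rle0.
by move=> /AM /=; rewrite normrZ gtr0_norm// divfK ?gt_eqF// lerD2l leNgt ltr1n.
Qed.

Lemma gauge_ge0 v : 0 <= g v.
Proof.
have [->|/gauge_gt0/ltW//] := eqVneq v 0; by rewrite gauge0.
Qed.

Lemma gauge_normalized v : v != 0 -> g ((g v)^-1 *: v) = 1.
Proof.
move=> v0; have gv := gauge_gt0 v0.
by rewrite gaugeZ ?invr_ge0 ?(ltW gv)// mulVf// gt_eqF.
Qed.

Lemma gaugeD x y : g (x + y) <= g x + g y.
Proof.
have [->|x0] := eqVneq x 0; first by rewrite gauge0 !add0r.
have [->|y0] := eqVneq y 0; first by rewrite gauge0 !addr0.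
have a0 := gauge_gt0 x0; have b0 := gauge_gt0 y0.
set a := g x in a0 *; set b := g y in b0 *.
have ab : 0 < a + b by rewrite addr_gt0.
have Ax : A (a^-1 *: x) by rewrite gauge_le1 gauge_normalized.
have Ay : A (b^-1 *: y) by rewrite gauge_le1 gauge_normalized.
have := convex_set_comb A_convex (t := a / (a + b)) Ax Ay.
rewrite divr_ge0 ?(ltW a0) ?(ltW ab)//= ler_pdivrMr// mul1r lerDl (ltW b0) => /(_ isT).
rewrite !scalerA (_ : a / (a + b) * a^-1 = (a + b)^-1); last first.
  by field; rewrite !gt_eqF.
rewrite (_ : (1 - a / (a + b)) / b = (a + b)^-1); last by field; rewrite !gt_eqF.
by rewrite -scalerDr gauge_le1 gaugeZ ?invr_ge0 ?(ltW ab)// ler_pdivrMl// mulr1.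
Qed.

(** The known interior point [x0] may differ from 0: for short vectors [g] is at most 1 on
    [x0 + k *: v], and subadditivity removes [x0] at the cost of [g (- x0)]. *)
Lemma gauge_le_norm : exists2 C : R, 0 < C & forall v, g v <= C * `|v|.
Proof.
have [x0 /nbhs_norm_ex[r r0 Hr]] := A_int.
pose c := 1 + g (- x0).
have c0 : 0 < c by rewrite ltr_pwDl// gauge_ge0.
exists (2 * c / r) => [|v]; first by rewrite !(divr_gt0, mulr_gt0).
have [->|v0] := eqVneq v 0; first by rewrite gauge0 normr0 mulr0.
have nv : 0 < `|v| by rewrite normr_gt0.
pose k := r / 2 / `|v|; have k0 : 0 < k by rewrite !divr_gt0.
have : g (k *: v) <= c.
  rewrite -[k *: v](addKr x0) addrC (le_trans (gaugeD _ _))// lerD2r.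
  rewrite -gauge_le1; apply: Hr; rewrite normrZ gtr0_norm// divfK ?gt_eqF//.
  by rewrite ltr_pdivrMr// ltr_pMr// ltr1n.
rewrite gaugeZ ?(ltW k0)// -ler_pdivlMl// => /le_trans; apply.
by rewrite le_eqVlt; apply/orP; left; apply/eqP; rewrite /k; field; rewrite !gt_eqF.
Qed.

Lemma gauge_lipschitz : exists2 C : R, 0 < C &
  forall x v, `|g (x + v) - g x| <= C * `|v|.
Proof.
have [C C0 HC] := gauge_le_norm; exists C => // x v.
rewrite ler_norml; apply/andP; split.
  rewrite lerNl opprB lerBlDl -normrN.
  by rewrite (le_trans _ (lerD (lexx _) (HC _)))// (le_trans _ (gaugeD _ _))// addrK.
by rewrite lerBlDl (le_trans (gaugeD _ _))// lerD2l.
Qed.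

Lemma gauge_continuous : continuous g.
Proof.
have [C C0 HC] := gauge_lipschitz.
move=> x; apply/cvgrPdist_le => e e0; apply/nbhs_norm_ex; exists (e / C) => [|v].
  by rewrite divr_gt0.
rewrite ltr_pdivlMr// mulrC => /ltW ve.
by rewrite distrC (le_trans (HC _ _)).
Qed.

Lemma gauge_interior v : g v < 1 -> interior A v.
Proof.
have [C C0 HC] := gauge_lipschitz => gv.
apply/nbhs_norm_ex; exists ((1 - g v) / C) => [|w].
  by rewrite divr_gt0// subr_gt0.
rewrite ltr_pdivlMr// mulrC => h; rewrite gauge_le1.
by have := le_lt_trans (HC v w) h; rewrite ltr_norml => /andP[_]; rewrite ltrD2r => /ltW.
Qed.

Lemma gauge_boundary v : boundary A v = (g v = 1) :> Prop.
Proof.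
apply/propext; rewrite /boundary.
have -> : closure A = A.
  apply/esym/closure_id; apply: compact_closed => //; exact: norm_hausdorff.
split => [[Av nAv]|gv].
  move: Av; rewrite gauge_le1 le_eqVlt => /predU1P[//|/gauge_interior].
  by move=> /nAv.
split; first by rewrite gauge_le1 gv.
have v0 : v != 0 by apply: contra_eq_neq gv => ->; rewrite gauge0 lt_eqF.
have nv : 0 < `|v| by rewrite normr_gt0.
move=> /nbhs_norm_ex[r r0 Hr].
pose k := r / 2 / `|v|; have k0 : 0 < k by rewrite !divr_gt0.
have : A (v + k *: v).
  apply: Hr; rewrite normrZ gtr0_norm// divfK ?gt_eqF//.
  by rewrite ltr_pdivrMr// ltr_pMr// ltr1n.
rewrite gauge_le1 -[X in X + _]scale1r -scalerDl gaugeZ ?(addr_ge0 ler01 (ltW k0))// gv mulr1.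
by rewrite gerDl leNgt k0.
Qed.

(** With [s = g (q + v)], the radial projection of [q + v] to the boundary is [q + k], where
    [s *: k = v - (s - 1) *: q]. Since [g0] vanishes at [q] and at [q + k], its differential is
    small on [k]. *)
Let boundary_approx U g0 q : boundary A q -> local_equation (boundary A) q U g0 ->
  forall e : R, 0 < e -> exists2 d : R, 0 < d & forall v, `|v| < d ->
    `|'d g0 q v - (g (q + v) - 1) * 'd g0 q q| <= e * `|v|.
Proof.
move=> bq [Uo Uq Usub US] e e0.
have [dg0 _ _] := Usub _ Uq.
have gq : g q = 1 by rewrite -gauge_boundary.
have on0 x : U x -> g x = 1 -> g0 x = 0.
  move=> Ux gx; have : (boundary A `&` U) x by split => //; rewrite gauge_boundary.
  by rewrite US => -[].
have [C C0 HC] := gauge_lipschitz.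
pose K := 2 * (1 + C * `|q|).
have K0 : 0 < K by rewrite mulr_gt0// ltr_pwDl// mulr_ge0// ltW.
have [r r0 Hr] : exists2 r : R, 0 < r & forall v, `|v| < r -> U (q + v).
  by apply/nbhs_norm_ex; exact: open_nbhs_nbhs.
have e'0 : 0 < e / (2 * K) by rewrite divr_gt0// mulr_gt0.
have [d0 d00 Hd0] := diff_approx dg0 e'0.
(* The three bounds ensure in turn that [s] exceeds 1/2, that [k] is within range of the first-order
   estimate for [g0], and that [q + k] stays in [U]. *)
exists (Num.min (2 * C)^-1 (Num.min (d0 / K) (r / K))) => [|v].
  by rewrite !lt_min invr_gt0 mulr_gt0//= !divr_gt0.
rewrite !lt_min !ltr_pdivlMr// => /and3P[v1 v2 v3].
have Cv : C * `|v| < 2^-1.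
  by move: v1; rewrite invfM -ltr_pdivrMr ?invr_gt0// invrK mulrC.
set s := g (q + v).
have /ler_normlP[s1 s2] : `|s - 1| <= C * `|v| by rewrite -gq HC.
have s0 : 0 < s by lra.
have sv : s^-1 <= 2 by rewrite -[leRHS]invrK lef_pV2 ?posrE ?invr_gt0//; lra.
pose k := s^-1 *: (v - (s - 1) *: q).
have qk : q + k = s^-1 *: (q + v).
  apply: (scalerI (lt0r_neq0 s0)); rewrite scalerDr !scalerA mulfV ?gt_eqF//.
  rewrite !scale1r scalerBl scale1r opprB addrC -!addrA addNr addr0.
  by rewrite addrC.
have nk : `|k| <= K * `|v|.
  rewrite normrZ ger0_norm ?invr_ge0 ?(ltW s0)// /K -mulrA.
  rewrite ler_pM ?invr_ge0 ?(ltW s0)// (le_trans (ler_normB _ _))// normrZ.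
  rewrite mulrDl mul1r lerD2l mulrAC ler_wpM2r//.
  by rewrite ler_norml; apply/andP; split; lra.
have qv0 : q + v != 0 by apply: contraTneq s0 => qv; rewrite /s qv gauge0 ltxx.
have g0k : g0 (q + k) = 0.
  apply: on0; last by rewrite qk gauge_normalized.
  by apply: Hr; rewrite (le_lt_trans nk)// mulrC.
have kd : `|k| < d0 by rewrite (le_lt_trans nk)// mulrC.
have := Hd0 _ kd; rewrite g0k (on0 q)// subr0 sub0r normrN.
rewrite /k linearZ linearB linearZ /= normrM gtr0_norm ?invr_gt0//.
rewrite ler_pdivrMl// => /le_trans; apply.
apply: (@le_trans _ _ (2 * (e / (2 * K) * (K * `|v|)))).
  apply: ler_pM; [exact: ltW|by rewrite mulr_ge0// ltW|by lra|].
  by rewrite ler_wpM2l// ltW.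
by rewrite le_eqVlt; apply/orP; left; apply/eqP; field; rewrite gt_eqF.
Qed.

(** Dividing [boundary_approx] by ['d g0 q q] gives the differential of [g]. Were that number zero,
    the same estimate would make ['d g0 q] vanish, against submersivity. *)
Lemma gauge_diff_local U g0 q : boundary A q ->
  local_equation (boundary A) q U g0 ->
  [/\ differentiable g q, 'd g0 q q != 0 &
      forall v, 'd g q v = 'd g0 q v / 'd g0 q q].
Proof.
move=> bq loc; have H := boundary_approx bq loc.
have [Uo Uq Usub US] := loc.
have [dg0 [h hn] _] := Usub _ Uq.
have gq : g q = 1 by rewrite -gauge_boundary.
have Dq : 'd g0 q q != 0.
  apply: contra_neq hn => Dq; apply/eqP; rewrite -normr_le0; apply/ler_addgt0Pr => t t0; rewrite add0r.
  have h1 : 0 < `|h| + 1 by rewrite ltr_wpDl.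
  have e0 : 0 < t / (`|h| + 1) by rewrite divr_gt0.
  have [d d0 Hd] := H _ e0.
  have [k k0 kh] : exists2 k : R, 0 < k & `|k *: h| < d.
    exists (d / (`|h| + 1)); first by rewrite divr_gt0.
    by rewrite normrZ gtr0_norm ?divr_gt0// mulrAC ltr_pdivrMr// ltr_pM2l// ltrDl.
  have := Hd _ kh; rewrite Dq mulr0 subr0 linearZ /= !normrZ mulrCA gtr0_norm//.
  rewrite ler_pM2l// => /le_trans; apply.
  by rewrite mulrAC ler_pdivrMr// ler_pM2l// lerDl.
pose D : {linear V -> R} := ('d g0 q q)^-1 \*: 'd g0 q.
have DE v : D v = 'd g0 q v / 'd g0 q q by rewrite /D /= mulrC.
have cD : continuous D.
  by move=> v; apply: cvgZl_tmp; exact: (diff_continuous dg0).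
have HD (e : R) : 0 < e -> exists2 d : R, 0 < d & forall v, `|v| < d ->
    `|g (q + v) - g q - D v| <= e * `|v|.
  move=> e_gt0; have nq := Dq; rewrite -normr_gt0 in nq.
  have [d d0 Hd] := H _ (mulr_gt0 e_gt0 nq).
  exists d => // v /Hd; rewrite gq DE distrC mulrAC => hv.
  by rewrite -(ler_pM2r nq) -normrM mulrBl divfK.
have [dg dgE] := approx_diff cD HD.
by split => // v; rewrite dgE.
Qed.

(** * The differential of the gauge as a supporting functional *)

Context (A_C1 : C1_hypersurface (boundary A)).

Lemma gauge_differentiable q : boundary A q -> differentiable g q.
Proof. by move=> bq; have [U [g0 /(gauge_diff_local bq)[]]] := A_C1 bq. Qed.

Lemma tangent_gauge q : boundary A q ->
  tangent_hyperplane (boundary A) q = [set v | 'd g q v = 0].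
Proof.
move=> bq; apply/seteqP; split => v /=.
  move=> [U [g0 [/(gauge_diff_local bq)[_ _ ->] ->]]]; exact: mul0r.
have [U [g0 loc]] := A_C1 bq; have [_ Dq ->] := gauge_diff_local bq loc.
move=> /eqP; rewrite mulf_eq0 invr_eq0 (negbTE Dq) orbF => /eqP D0.
by exists U, g0.
Qed.

Lemma gauge_diff_self q : boundary A q -> 'd g q q = 1.
Proof.
move=> bq; have [U [g0 loc]] := A_C1 bq.
by have [_ Dq ->] := gauge_diff_local bq loc; exact: divff.
Qed.

Let le_diff q v (c : R) : boundary A q ->
  (forall t : R, 0 < t -> 1 + t * c <= g (q + t *: v)) -> c <= 'd g q v.
Proof.
move=> bq H; apply/ler_addgt0Pr => t t0.
have gq : g q = 1 by rewrite -gauge_boundary.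
have v1 : 0 < `|v| + 1 by rewrite ltr_wpDl.
have e0 : 0 < t / (`|v| + 1) by rewrite divr_gt0.
have [d d0 Hd] := diff_approx (gauge_differentiable bq) e0.
have [k k0 kv] : exists2 k : R, 0 < k & `|k *: v| < d.
  exists (d / (`|v| + 1)); first by rewrite divr_gt0.
  by rewrite normrZ gtr0_norm ?divr_gt0// mulrAC ltr_pdivrMr// ltr_pM2l// ltrDl.
have /ler_normlP[_] := Hd _ kv; rewrite gq linearZ /= -[k *: 'd g q v]/(k * 'd g q v).
have := H _ k0.
have : t / (`|v| + 1) * `|k *: v| <= k * t.
  rewrite normrZ gtr0_norm// mulrCA ler_pM2l// mulrAC ler_pdivrMr//.
  by rewrite ler_pM2l// lerDl.
by move=> h1 h2 h3; rewrite -(ler_pM2l k0) mulrDr; move: h1 h2 h3; lra.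
Qed.

Lemma diff_le_gauge q x : boundary A q -> 'd g q x <= g x.
Proof.
move=> bq; rewrite -lerN2 -linearN; apply: le_diff => // t t0.
have gq : g q = 1 by rewrite -gauge_boundary.
rewrite mulrN lerBlDr -gq -(gaugeZ _ (ltW t0)) (le_trans _ (gaugeD _ _))//.
by rewrite scalerN subrK.
Qed.

(** This finds a boundary point with prescribed conormal direction. At a maximiser [q] of [f] on
    [A], with [m = f q], homogeneity gives [f <= m * g] with equality at [q]; hence
    [f <= m * 'd g q], and linearity turns this into equality. *)
Lemma boundary_normal (f : {linear V -> R}) : continuous f ->
  (exists v, f v != 0) ->
  exists q (m : R), [/\ boundary A q, 0 < m & forall v, f v = m * 'd g q v].
Proof.
move=> cf [v0 fv0].
have A0 : A 0 by rewrite gauge_le1 gauge0 ler01.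
have [q + qmax] := compact_EVT_max (ex_intro _ _ A0) A_compact
  (continuous_subspaceT cf).
rewrite inE => Aq; pose m := f q.
have fle x : f x <= m * g x.
  have [->|x0] := eqVneq x 0; first by rewrite linear0 gauge0 mulr0.
  have gx := gauge_gt0 x0.
  have := qmax ((g x)^-1 *: x); rewrite inE gauge_le1 gauge_normalized// lexx.
  by move=> /(_ isT); rewrite linearZ /= -/m ler_pdivrMl// mulrC.
have m0 : 0 < m.
  have [v fv] : exists v, 0 < f v.
    have [?|?] := ltP 0 (f v0); first by exists v0.
    by exists (- v0); rewrite linearN oppr_gt0 lt_neqAle fv0.
  rewrite ltNge; apply/negP => m0; have := lt_le_trans fv (fle v).
  by rewrite ltNge mulr_le0_ge0// gauge_ge0.
have gq : g q = 1.
  apply/eqP; rewrite eq_le; apply/andP; split; first by rewrite -gauge_le1.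
  by have := fle q; rewrite -/m -[leLHS]mulr1 ler_pM2l.
have bq : boundary A q by rewrite gauge_boundary.
have le v : f v <= m * 'd g q v.
  rewrite -ler_pdivrMl//; apply: le_diff => // t t0.
  rewrite -(ler_pM2l m0) (le_trans _ (fle _))// linearD linearZ /= -/m.
  by rewrite mulrDr mulr1 lerD2l mulrCA mulVKf// gt_eqF.
exists q, m; split => // v; apply/eqP; rewrite eq_le le /=.
by have := le (- v); rewrite !linearN /= mulrN lerN2.
Qed.

Lemma chord_exit p f : g p < 1 -> f != 0 ->
  exists2 t : R, 0 < t & g (p + t *: f) = 1.
Proof.
move=> gp f0; have gf := gauge_gt0 f0.
(* By subadditivity [g (p + b *: f)] is at least [b * g f - g (- p) = 1]. *)
pose b := (1 + g (- p)) / g f.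
have b0 : 0 < b by rewrite divr_gt0// ltr_pwDl// gauge_ge0.
have c : {within `[0, b], continuous (fun t : R => g (p + t *: f))}.
  apply: continuous_subspaceT => t.
  apply: (@continuous_comp _ _ _ (fun t : R => p + t *: f) g); last first.
    exact: gauge_continuous.
  by apply: cvgD; [exact: cvg_cst|exact: scalel_continuous].
have gb : 1 <= g (p + b *: f).
  have := gaugeD (p + b *: f) (- p).
  by rewrite addrAC subrr add0r gaugeZ ?(ltW b0)// divfK ?gt_eqF// lerD2r.
have [] := IVT (v := 1) (ltW b0) c.
  rewrite scale0r addr0 ge_min le_max gb (ltW gp) orbT//.
move=> t; rewrite in_itv /= => /andP[t0 _] gt; exists t => //.
rewrite lt_neqAle t0 andbT; apply: contra_ltN gp => /eqP t00.
by rewrite -gt -t00 scale0r addr0.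
Qed.

Lemma diff_exit_gt0 p f t : g p < 1 -> 0 < t -> g (p + t *: f) = 1 ->
  0 < 'd g (p + t *: f) f.
Proof.
move=> gp t0 gt; have bt : boundary A (p + t *: f) by rewrite gauge_boundary.
have := gauge_diff_self bt; rewrite linearD linearZ /=.
set D := 'd g _; rewrite -[t *: D f]/(t * D f) => E.
rewrite -(pmulr_rgt0 _ t0) -(ltrD2l (D p)) E addr0.
exact: le_lt_trans (diff_le_gauge _ bt) gp.
Qed.

(* The two exit times [a] and [s] of the chord of A through an interior point
   in the directions f and - f are such that [a] and [s - 2 W] have a common
   supergradient at every point, hence differ by a constant. *)
Lemma chord_reflection f (W : {linear V -> R}) : f != 0 -> W f = 1 ->
  (forall p t, boundary A p -> 0 < t -> boundary A (p - t *: f) ->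
     0 < 'd g p f -> exists2 c : R, 0 < c & forall v,
       'd g (p - t *: f) v = c * ('d g p v - 2 * 'd g p f * W v)) ->
  exists kappa : R, forall x, A x -> A (x + (kappa - 2 * W x) *: f).
Proof.
move=> f0 Wf refl.
have /choice[a aP] p : exists t : R, g p < 1 -> 0 < t /\ g (p + t *: f) = 1.
  have [gp|gp] := ltP (g p) 1; last by exists 0.
  by have [t ? ?] := chord_exit gp f0; exists t.
have /choice[s sP] p : exists t : R, g p < 1 -> 0 < t /\ g (p - t *: f) = 1.
  have [gp|gp] := ltP (g p) 1; last by exists 0.
  have fN0 : - f != 0 by rewrite oppr_eq0.
  by have [t ? ht] := chord_exit gp fN0; exists t; rewrite -scalerN.
have super p : g p < 1 -> exists eta : {linear V -> R}, forall x, g x < 1 ->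
    a x <= a p + eta (x - p) /\
    s x - 2 * W x <= s p - 2 * W p + eta (x - p).
  move=> gp; have [ap0 gap] := aP _ gp; have [sp0 gsp] := sP _ gp.
  have Df := diff_exit_gt0 gp ap0 gap.
  set q := p + a p *: f in gap Df.
  have bq : boundary A q by rewrite gauge_boundary.
  have qE : q - (a p + s p) *: f = p - s p *: f.
    by rewrite /q scalerDl opprD addrA addrK.
  have [|||c c0 cE] := refl q (a p + s p) bq; rewrite ?qE ?gauge_boundary ?addr_gt0//.
  rewrite qE in cE.
  (* This is the gradient of [a] at [p] that implicit differentiation of [g (x + a x *: f) = 1]
     suggests. *)
  have [eta etaE] : exists eta : {linear V -> R},
      forall v, eta v = - ('d g q v / 'd g q f).
    exists ((- ('d g q f)^-1) \*: 'd g q) => v /=.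
    by rewrite [LHS]mulrC mulrN.
  exists eta => x gx; have [ax0 gax] := aP _ gx; have [sx0 gsx] := sP _ gx.
  have etaM v : 'd g q v = - eta v * 'd g q f by rewrite etaE opprK divfK// gt_eqF.
  have WB : W (x - p) = W x - W p by rewrite linearB.
  (* Each inequality says that an end of the chord through [x] lies on the inner side of the
     supporting hyperplane at the matching end of the chord through [p]; at the second end [refl]
     gives the conormal up to the factor [c > 0]. *)
  split.
    have := diff_le_gauge (x + a x *: f) bq; rewrite gax -(gauge_diff_self bq).
    rewrite {2}/q 2!linearD 2!linearZ /=; set D := 'd g q in etaM Df *.
    rewrite -![_ *: D f]/(_ * D f) => h.
    have : D (x - p) <= (a p - a x) * D f by rewrite linearB mulrBl; move: h; lra.
    rewrite etaM ler_pM2r//. lra.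
  have bq' : boundary A (p - s p *: f) by rewrite gauge_boundary.
  have : 'd g (p - s p *: f) (x - s x *: f) <= 'd g (p - s p *: f) (p - s p *: f).
    by rewrite (gauge_diff_self bq') -gsx; exact: diff_le_gauge.
  rewrite -subr_le0 -linearB
    (_ : x - s x *: f - (p - s p *: f) = (x - p) - (s x - s p) *: f); last first.
    by rewrite scalerBl !opprD !opprK addrACA.
  rewrite cE pmulr_rle0// etaM [eta (_ - _ *: f)]linearB [W (_ - _)]linearB [eta (_ *: f)]linearZ
    [W (_ *: f)]linearZ /= WB.
  rewrite -[_ *: eta f]/(_ * eta f) -[_ *: W f]/(_ * W f) Wf.
  have -> : eta f = -1 by rewrite etaE divff// gt_eqF.
  set D := 'd g q f in Df *; set ex := eta (x - p) => h.
  have : D * ((s x - s p) - ex - 2 * (W x - W p)) <= 0 by move: h; lra.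
  by rewrite pmulr_rle0//; lra.
pose kappa := a 0 - s 0.
exists kappa => x Ax.
(* For interior [y] the displacement is [a y - s y], so the image is the mirror image of [y] in the
   midpoint of its chord and stays on the chord. *)
have int y : g y < 1 -> A (y + (kappa - 2 * W y) *: f).
  move=> gy; have [ay gay] := aP _ gy; have [sy gsy] := sP _ gy.
  have -> : kappa - 2 * W y = a y - s y.
    have : a y - (s y - 2 * W y) = a 0 - (s 0 - 2 * W 0).
      apply: (common_supergradient (D := [set p | g p < 1]) (a := a)
        (b := fun p => s p - 2 * W p) _ super) => //=; last by rewrite gauge0.
      move=> u v t gu gv /andP[t0 t1].
      have -> : u + t *: (v - u) = t *: v + (1 - t) *: u.
        by rewrite scalerBr scalerBl scale1r addrCA.
      rewrite (le_lt_trans (gaugeD _ _))// !gaugeZ ?subr_ge0//.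
      have [->|t1'] := eqVneq t 1; first by rewrite subrr mul0r addr0 mul1r.
      have t1l : 0 < 1 - t by rewrite subr_gt0 lt_neqAle t1'.
      have : (1 - t) * g u < 1 - t by rewrite -[ltRHS]mulr1 ltr_pM2l.
      have : t * g v <= t by rewrite -[leRHS]mulr1 ler_wpM2l// ltW.
      by lra.
    by rewrite linear0 /kappa; lra.
  have as0 : 0 < a y + s y by rewrite addr_gt0.
  have := convex_set_comb A_convex (x := y + a y *: f) (y := y - s y *: f)
    (t := a y / (a y + s y)).
  rewrite !gauge_le1 gay gsy !lexx divr_ge0 ?(ltW ay) ?(ltW as0)//=.
  rewrite ler_pdivrMr// mul1r lerDl (ltW sy) => /(_ isT isT isT).
  set w := a y / _; suff -> : w *: (y + a y *: f) + (1 - w) *: (y - s y *: f)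
      = y + (a y - s y) *: f by [].
  rewrite !scalerDr addrACA -scalerDl (addrC w) subrK scale1r; congr (_ + _).
  rewrite scalerN !scalerA -scalerBl; congr (_ *: _).
  by rewrite /w; field; rewrite gt_eqF.
move: Ax; rewrite !gauge_le1 => gx; apply/ler_addgt0Pr => e e0.
(* A point [x] of the boundary is approached by [l *: x] with [l < 1]; the image of [x] is that of
   [l *: x] plus [(1 - l) *: u], whose gauge is at most [e]. *)
pose u := x - (2 * W x) *: f.
have gu0 := gauge_ge0 u.
have [l [l0 l1 le]] : exists l : R, [/\ 0 <= l, l < 1 & (1 - l) * g u <= e].
  exists (1 - e / (g u + e)).
  have ue : 0 < g u + e by rewrite ltr_wpDl.
  split.
  - by rewrite subr_ge0 ler_pdivrMr// mul1r lerDr.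
  - by rewrite gtrDl oppr_lt0 divr_gt0.
  - rewrite opprB addrC subrK mulrAC ler_pdivrMr// ler_pM2l// lerDl ltW//.
have lx : g (l *: x) < 1.
  rewrite gaugeZ//; apply: le_lt_trans l1.
  by rewrite -[leRHS]mulr1 ler_wpM2l.
have := int _ lx; rewrite gauge_le1 => gl.
have -> : x + (kappa - 2 * W x) *: f
    = (l *: x + (kappa - 2 * W (l *: x)) *: f) + (1 - l) *: u.
  rewrite /u [W (l *: x)]linearZ /= -[l *: W x]/(l * W x) scalerBr addrACA -scalerDl.
  rewrite (addrC l) subrK scale1r; congr (_ + _).
  by rewrite scalerA -scalerBl; congr (_ *: _); ring.
by rewrite (le_trans (gaugeD _ _))// gaugeZ ?subr_ge0 ?(ltW l1)// lerD.
Qed.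

End gauges.

(** * Billiards *)

Section pairing.
Context {R : realType} {n : nat}.

Definition row_pairing (f : 'rV[R]_n) (v : 'cV[R]_n) : R := (f *m v) 0 0.

Definition col_pairing (w : 'cV[R]_n) (x : 'rV[R]_n) : R := (x *m w) 0 0.

Fact row_pairing_linear f : linear (row_pairing f : 'cV[R]_n -> R).
Proof. by move=> a u v; rewrite /row_pairing mulmxDr -scalemxAr !mxE. Qed.

HB.instance Definition _ f :=
  GRing.isLinear.Build R 'cV[R]_n R *:%R (row_pairing f) (row_pairing_linear f).

Fact col_pairing_linear w : linear (col_pairing w : 'rV[R]_n -> R).
Proof. by move=> a u v; rewrite /col_pairing mulmxDl -scalemxAl !mxE. Qed.

HB.instance Definition _ w :=
  GRing.isLinear.Build R 'rV[R]_n R *:%R (col_pairing w) (col_pairing_linear w).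

Lemma row_pairing_continuous f : continuous (row_pairing f).
Proof.
rewrite /row_pairing; under eq_fun do rewrite mxE.
apply: sum_continuous => i; apply: fun_mul_continuous; first exact: cst_continuous.
exact: coord_continuous.
Qed.

Lemma vector_diffE (g : 'rV[R]_n -> R) p x :
  'd g p x = (x *m vector_diff g p) 0 0.
Proof.
rewrite mxE {1}[x]row_sum_delta linear_sum; apply: eq_bigr => i _.
by rewrite linearZ mxE.
Qed.

Lemma mem_leigenspace (f : 'End('cV[R]_n)) a v :
  (v \in passmx.leigenspace f a) = (f v == a *: v).
Proof.
by rewrite memv_ker add_lfunE opp_lfunE scale_lfunE id_lfunE subr_eq0.
Qed.

(** [H q] fixes the kernel of [f], which is the tangent hyperplane, and negates some nonzero [w0];
    so [f] does not vanish on [w0], and splitting [v] along the kernel and the normalized [w0] gives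
    the formula. *)
Lemma billiard_reflection (K : set 'cV[R]_n) (F : 'cV[R]_n -> R) H q
    (f : 'rV[R]_n) (m : R) :
  tangent_hyperplane (boundary K) q = [set v | 'd F q v = 0] ->
  projective_billiard K H -> boundary K q -> m != 0 ->
  (forall v, row_pairing f v = m * 'd F q v) ->
  exists2 w : 'cV[R]_n, f *m w = 1%:M &
    forall v, H q v = v - (2 * row_pairing f v) *: w.
Proof.
move=> tan bil bq m0 fE; have [_ _ eN Htan] := bil _ bq.
have fixH v : row_pairing f v = 0 -> H q v = v.
  move=> fv; have : v \in passmx.leigenspace (H q) 1.
    suff : [set v | v \in passmx.leigenspace (H q) 1] v by [].
    by rewrite Htan tan /=; apply/eqP; rewrite -(mulrI_eq0 _ (mulfI m0)) -fE fv.
  by rewrite mem_leigenspace scale1r => /eqP.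
have [w0 w0n Hw0] : exists2 w, w != 0 & H q w = - w.
  exists (vpick (passmx.leigenspace (H q) (-1))); first by rewrite vpick0.
  have := memv_pick (passmx.leigenspace (H q) (-1)).
  by rewrite mem_leigenspace scaleN1r => /eqP.
have fw0 : row_pairing f w0 != 0.
  apply: contra_neq w0n => /fixH; rewrite Hw0 => /eqP.
  rewrite eq_sym -addr_eq0 -mulr2n -scaler_nat scaler_eq0 pnatr_eq0 /=.
  by move/eqP.
exists ((row_pairing f w0)^-1 *: w0).
  rewrite -scalemxAr [f *m w0]mx11_scalar -/(row_pairing f w0).
  by rewrite scale_scalar_mx mulVf.
set w := _ *: w0 => v.
have fw : row_pairing f w = 1 by rewrite /w linearZ /= [LHS]mulVf.
have Hw : H q w = - w by rewrite /w linearZ /= Hw0 scalerN.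
have : row_pairing f (v - row_pairing f v *: w) = 0.
  by rewrite linearB linearZ /= fw -[_ *: 1]/(_ * 1) mulr1 subrr.
move=> /fixH; rewrite linearB linearZ /= Hw scalerN opprK => h.
by rewrite -[LHS](addrK (row_pairing f v *: w)) h mulr2n mulrDl mul1r scalerDl opprD addrA.
Qed.

End pairing.

Theorem theorem1 (R : realType) (n : nat) (n_ge2 : (2 <= n)%N)
    (T : set 'rV[R]_n) (Ft : 'rV[R]_n -> R)
    (T_body : C1_strictly_convex_body T)
    (T_origin : barycentre T = 0)
    (T_gauge : gauge_of T Ft) :
  (exists (K : set 'cV[R]_n) (F : 'cV[R]_n -> R)
          (H : 'cV[R]_n -> 'End('cV[R]_n)),
     [/\ C1_strictly_convex_body K,
         barycentre [set q^T | q in K] = 0,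
         gauge_of K F,
         projective_billiard K H &
         same_trajectories K F T Ft H]) ->
  ellipsoid T.
Proof.
move=> [K [F [H [[[Kc Kcvx Kint _] K_C1] _ K_gauge bil same]]]].
have [[Tc Tcvx Tint _] T_C1] := T_body.
have T0 : T 0 by rewrite (gauge_le1 T_gauge) (gauge0 T_gauge) ler01.
have Tsym f : f != 0 -> symmetric_along T f.
  move=> f0.
  (* At this [q] the conormal of [K] is parallel to [f], so the Minkowski law moves momenta along
     lines of direction [f]. *)
  have [|q [m [bq m0 fE]]] := boundary_normal Kc Kcvx Kint K_gauge K_C1
    (@row_pairing_continuous R n f).
    have [i fi] : exists i, f 0 i != 0.
      apply/existsP; apply: contraR f0; rewrite negb_exists => /forallP fi.
      by apply/eqP/rowP => i; rewrite mxE; apply/eqP; have := fi i; rewrite negbK.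
    by exists (delta_mx i 0); rewrite /= /row_pairing -colE mxE.
  have m0' := lt0r_neq0 m0.
  have tan := tangent_gauge Kc Kcvx Kint K_gauge K_C1 bq.
  have [w fw HE] := billiard_reflection tan bil bq m0' fE.
  have qF : covector_diff F q = m^-1 *: f.
    apply/rowP => i; rewrite !mxE -[LHS](mulKf m0') -fE.
    by rewrite /= /row_pairing -colE mxE.
  have [||kappa Tkappa] := chord_reflection Tc Tcvx Tint T_gauge T_C1
    (W := col_pairing w) f0; last by exists w, kappa.
    by rewrite /= /col_pairing fw mxE.
  move=> p t bp t0 bpt Df.
  have Dv : row_pairing f (vector_diff Ft p) = 'd Ft p f by rewrite [RHS]vector_diffE.
  (* Taking the differential of [Ft] at [p] as incoming velocity makes [p] the incoming momentum and
     [p - t *: f] the outgoing one. *)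
  have [||c c0 cE] := same q (vector_diff Ft p) bq _ (vector_diff Ft (p - t *: f)).
  - by rewrite -(pmulr_rgt0 _ m0) -fE /= Dv.
  - exists p; split => //; first by exists 1; rewrite ?scale1r.
    left; exists (p - t *: f); split => //.
      by rewrite -subr_eq0 addrAC subrr add0r oppr_eq0 scaler_eq0 negb_or gt_eqF.
    exists (- (t * m)) => //=.
    by rewrite qF scalerA mulNr mulfK// scaleNr.
  exists c => // x; rewrite [LHS]vector_diffE [in RHS]vector_diffE cE HE Dv.
  by rewrite -scalemxAr mulmxBr -scalemxAr /= /col_pairing !mxE.
(* Small enough for every [r *: delta_mx 0 i] to lie in [T]; the summand 1 keeps the denominator
   positive. *)
pose r := (1 + \sum_(i < n) Ft (delta_mx 0 i))^-1.
have Ft0 v : 0 <= Ft v by exact: (gauge_ge0 Tc T_gauge).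
have r1 : 0 < 1 + \sum_(i < n) Ft (delta_mx 0 i) by rewrite ltr_pwDl// sumr_ge0.
have r0 : 0 < r by rewrite invr_gt0.
apply: (reflections_ellipsoid (r := r) (ltnW n_ge2) Tc _ r0 T0) => //.
  exact: convex_set_comb Tcvx.
move=> i; rewrite (gauge_le1 T_gauge) (gaugeZ T_gauge) ?(ltW r0)//.
rewrite ler_pdivrMl// mulr1 (bigD1 i)//= addrCA lerDl.
by rewrite addr_ge0// sumr_ge0.
Qed.
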